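(* Let $\mathsf{T}=\mathsf{K}+(\Box p\to p)$ and $\mathsf{D}=\mathsf{K}+(\Box p\to\Diamond p)$, and let $(\mathsf{mix})$ be the tri-modal formula $\Box p\to \Box_1\Box_2 p\land\Box_2\Box_1 p$. Then $$\mathsf{T}\times_n^+\mathsf{T}=\mathsf{T}\otimes\mathsf{T}\otimes\mathsf{T}+(\mathsf{mix})\qquad\text{and}\qquad \mathsf{D}\times_n^+\mathsf{D}=\mathsf{D}\otimes\mathsf{D}\otimes\mathsf{D}+(\mathsf{mix}),$$ where $L_1\times_n^+L_2$ denotes the tri-modal logic of all full products $\mathcal X\times_n^+\mathcal Y$ of neighborhood frames $\mathcal X\vDash L_1$ and $\mathcal Y\vDash L_2$.
   Context: Syntax. Let $\mathsf{AP}$ be a set of atomic propositions; $p,q$ denote distinct elements of $\mathsf{AP}$. Formulas over a finite set of unary modal operators are built from $\bot$, atoms, $\neg,\land$ and the boxes; other Boolean connectives are the usual abbreviations and $\Diamond\varphi:=\neg\Box\neg\varphi$ for each box (likewise with indices). Uni-modal formulas use $\Box$; tri-modal formulas use $\Box_1,\Box_2,\Box$. Normal logics. A normal modal logic is a set of formulas containing all propositional tautologies and, for each box $\blacksquare$ of the language, the axiom $\blacksquare(p\to q)\to(\blacksquare p\to\blacksquare q)$, and closed under modus ponens, generalization ($\varphi/\blacksquare\varphi$ for each box) and uniform substitution. $\mathsf{K}$ is the smallest normal uni-modal logic. $\Lambda+\varphi$ is the smallest normal logic (in the same language) containing $\Lambda$ and $\varphi$. For uni-modal logics $L_1,L_2,L_3$,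 the fusion $L_1\otimes L_2\otimes L_3$ is the smallest normal tri-modal logic over $\Box_1,\Box_2,\Box$ containing $L_1$ with $\Box$ renamed to $\Box_1$, $L_2$ with $\Box$ renamed to $\Box_2$, and $L_3$ (with $\Box$ kept). Neighborhood semantics. A $k$-neighborhood frame is $(X,\tau_1,\dots,\tau_k)$ with $X\neq\emptyset$ and each $\tau_i:X\to 2^{2^X}$ such that every $\tau_i(x)$ is a filter on $X$, meaning a non-empty family of subsets of $X$ closed under supersets and finite intersections ($\emptyset\in\tau_i(x)$ is allowed). Given a valuation $\nu:\mathsf{AP}\to2^X$, truth at a point is defined by: $x\vDash p$ iff $x\in\nu(p)$; Boolean clauses as usual; for the box associated with $\tau_i$, the box of $\varphi$ holds at $x$ iff $\{y\in X\mid y\vDash\varphi\}\in\tau_i(x)$. A formula is valid on a frame if it is true at all points under all valuations; a frame validates a logic $L$ if all formulas of $L$ are valid on it. The logic of a class of frames is the set of formulas valid on all its members. Full product. For uni-modal neighborhood frames $\mathcal X=(X,\tau_1)$, $\mathcal Y=(Y,\tau_2)$, let $\mathcal X\times_n^+\mathcal Y=(X\times Y,\tau_1',\tau_2',\tau)$ with $\tau_1'(x,y)=\{U\subseteq X\times Y\mid \exists V\in\tau_1(x): V\times\{y\}\subseteq U\}$, $\tau_2'(x,y)=\{U\subseteq X\times Y\mid \exists V\in\tau_2(y): \{x\}\times V\subseteq U\}$, $\tau(x,y)=\{U\subseteq X\times Y\mid \exists W\in\tau_1(x)\,\exists V\in\tau_2(y): W\times V\subseteq U\}$. The operators $\Box_1,\Box_2,\Box$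 are interpreted by $\tau_1',\tau_2',\tau$ respectively. $L_1\times_n^+L_2$ is the set of tri-modal formulas valid on $\mathcal X\times_n^+\mathcal Y$ for all uni-modal neighborhood frames $\mathcal X$ validating $L_1$ and $\mathcal Y$ validating $L_2$. *)

(* Defs.v *)
From mathcomp Require Import all_boot.
From mathcomp Require Import boolp classical_sets filter.

Set Implicit Arguments.
Unset Strict Implicit.
Unset Printing Implicit Defensive.

Local Open Scope classical_set_scope.

(** * Syntax *)

(* [I] indexes the boxes of the language and [AP] is the set of atoms. *)
Inductive form (I AP : Type) : Type :=
| Bot
| Atom of AP
| Neg of form I AP
| And of form I AP & form I AP
| Box of I & form I AP.

Arguments Bot {I AP}.
Arguments Atom {I AP} _.
Arguments Neg {I AP} _.
Arguments And {I AP} _ _.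
Arguments Box {I AP} _ _.

Definition Imp {I AP : Type} (f g : form I AP) : form I AP := Neg (And f (Neg g)).
Definition Dia {I AP : Type} (i : I) (f : form I AP) : form I AP := Neg (Box i (Neg f)).

(* The tri-modal language: [b1], [b2] and [b12] index the boxes written
   Box_1, Box_2 and Box (without index).  The uni-modal language has [I := unit]. *)
Inductive tri : Type := b1 | b2 | b12.

Fixpoint subst {I AP : Type} (s : AP -> form I AP) (f : form I AP) : form I AP :=
  match f with
  | Bot => Bot
  | Atom a => s a
  | Neg g => Neg (subst s g)
  | And g h => And (subst s g) (subst s h)
  | Box i g => Box i (subst s g)
  end.

Fixpoint rename {I J AP : Type} (r : I -> J) (f : form I AP) : form J AP :=
  match f with
  | Bot => Bot
  | Atom a => Atom a
  | Neg g => Neg (rename r g)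
  | And g h => And (rename r g) (rename r h)
  | Box i g => Box (r i) (rename r g)
  end.

(** * Normal modal logics *)

(* Boolean evaluation in which boxed formulas are treated as additional atoms. *)
Fixpoint beval {I AP : Type} (a : AP -> bool) (b : I -> form I AP -> bool)
    (f : form I AP) : bool :=
  match f with
  | Bot => false
  | Atom x => a x
  | Neg g => ~~ beval a b g
  | And g h => beval a b g && beval a b h
  | Box i g => b i g
  end.

(* Tautologies in the modal language: all formulas obtained from tautologies of
   propositional logic, over any number of letters, by substitution. *)
Definition tautology {I AP : Type} (f : form I AP) : Prop :=
  forall (a : AP -> bool) (b : I -> form I AP -> bool), beval a b f.

(* The axioms below are stated, as usual, for two fixed atoms [p] and [q]
   (distinct in the intended use). *)
Definition axK {I AP : Type} (p q : AP) (i : I) : form I AP :=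
  Imp (Box i (Imp (Atom p) (Atom q)))
      (Imp (Box i (Atom p)) (Box i (Atom q))).

Record normal {I AP : Type} (p q : AP) (L : set (form I AP)) : Prop := Normal {
  normal_taut : forall f, tautology f -> L f;
  normal_K : forall i, L (axK p q i);
  normal_mp : forall f g, L (Imp f g) -> L f -> L g;
  normal_gen : forall i f, L f -> L (Box i f);
  normal_subst : forall s f, L f -> L (subst s f)
}.

Definition add_axiom {I AP : Type} (p q : AP) (L : set (form I AP))
    (f : form I AP) : set (form I AP) :=
  smallest (normal p q) (L `|` [set f]).

Definition logicK {AP : Type} (p q : AP) : set (form unit AP) :=
  smallest (normal p q) set0.

Definition logicT {AP : Type} (p q : AP) : set (form unit AP) :=
  add_axiom p q (logicK p q) (Imp (Box tt (Atom p)) (Atom p)).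

Definition logicD {AP : Type} (p q : AP) : set (form unit AP) :=
  add_axiom p q (logicK p q) (Imp (Box tt (Atom p)) (Dia tt (Atom p))).

Definition fusion {AP : Type} (p q : AP) (L1 L2 L3 : set (form unit AP)) :
    set (form tri AP) :=
  smallest (normal p q)
    (rename (fun=> b1) @` L1 `|` rename (fun=> b2) @` L2
      `|` rename (fun=> b12) @` L3).

Definition mix {AP : Type} (p : AP) : form tri AP :=
  Imp (Box b12 (Atom p))
      (And (Box b1 (Box b2 (Atom p))) (Box b2 (Box b1 (Atom p)))).

(** * Neighborhood semantics *)

(* [Filter] does not require properness: the empty set may be a neighborhood. *)
Record nframe (I : Type) := NFrame {
  carrier :> Type;
  tau : I -> carrier -> set_system carrier;
  carrier_neq0 : [set: carrier] !=set0;
  tau_filter : forall i x, Filter (tau i x)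
}.

Fixpoint truth {I AP : Type} (F : nframe I) (v : AP -> set F) (f : form I AP) :
    set F :=
  match f with
  | Bot => set0
  | Atom a => v a
  | Neg g => ~` truth v g
  | And g h => truth v g `&` truth v h
  | Box i g => [set x | tau i x (truth v g)]
  end.

Definition valid {I AP : Type} (F : nframe I) (f : form I AP) : Prop :=
  forall (v : AP -> set F) (x : F), truth v f x.

Definition validates {I AP : Type} (F : nframe I) (L : set (form I AP)) : Prop :=
  forall f, L f -> valid F f.

(** * Full products *)

(* [filter_prod F G] is the family of all supersets of [W `*` V] with
   [F W] and [G V]. *)
Definition prod_tau (X Y : nframe unit) (i : tri) (z : X * Y) :
    set_system (X * Y) :=
  match i with
  | b1 => filter_from (tau tt z.1) (fun V => V `*` [set z.2])
  | b2 => filter_from (tau tt z.2) (fun V => [set z.1] `*` V)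
  | b12 => filter_prod (tau tt z.1) (tau tt z.2)
  end.

Lemma prod_neq0 (X Y : nframe unit) : [set: X * Y] !=set0.
Proof.
by have [x _] := carrier_neq0 X; have [y _] := carrier_neq0 Y; exists (x, y).
Qed.

Lemma prod_tau_filter (X Y : nframe unit) (i : tri) (z : X * Y) :
  Filter (prod_tau i z).
Proof.
have FX := tau_filter tt z.1; have FY := tau_filter tt z.2.
case: i => /=; last exact: filter_prod_filter.
- apply: filter_from_filter; first by exists setT; exact: filterT.
  move=> V W hV hW; exists (V `&` W); first exact: filterI.
  by move=> [a b] [[? ?] ?].
- apply: filter_from_filter; first by exists setT; exact: filterT.
  move=> V W hV hW; exists (V `&` W); first exact: filterI.
  by move=> [a b] [? [? ?]].
Qed.

Definition full_prod (X Y : nframe unit) : nframe tri :=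
  NFrame (prod_neq0 X Y) (@prod_tau_filter X Y).

Definition product_logic {AP : Type} (L1 L2 : set (form unit AP)) :
    set (form tri AP) :=
  [set f | forall X Y : nframe unit,
    validates X L1 -> validates Y L2 -> valid (full_prod X Y) f].

(* Main.v *)
(* Completeness.  In the canonical Kripke model of the right-hand logic the three
   relations are reflexive (resp. serial), and (mix) says that R1 o R2 and R2 o R1
   are included in R.  Take as points of both factors finite words over the worlds
   with blanks ([None]); a neighborhood of a word consists of its extensions by one
   letter put at an arbitrarily late position (and of the word itself, for T).
   A pair of words is read synchronously, position by position, as a path from a
   root world: a letter facing a blank is an R1- or an R2-step, and two letters at
   the same position are an R-step.  Extending both words of a pair late enough by
   one letter each thus gives an R-step when the positions agree, and an R1-step
   and an R2-step in some order otherwise, which by (mix) is again an R-step.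
   Hence reading maps the full product to the canonical frame, preserving and
   reflecting neighborhoods, and a canonical refutation pulls back. *)
From mathcomp Require Import all_boot.
From mathcomp Require Import boolp classical_sets filter.
Require Import Defs.

Set Implicit Arguments.
Unset Strict Implicit.
Unset Printing Implicit Defensive.

Local Open Scope classical_set_scope.

(** * Normal logics and validity *)

Lemma smallest_normal (I AP : Type) (p q : AP) (S : set (form I AP)) :
  normal p q (smallest (normal p q) S).
Proof.
split=> [f tf M [nM _]|i M [nM _]|f g Lfg Lf M SM|i f Lf M SM|s f Lf M SM].
- exact: normal_taut nM _ tf.
- exact: normal_K nM i.
- by case: (SM) => nM _; apply: (normal_mp nM) (Lf M SM); exact: Lfg.
- by case: (SM) => nM _; apply: (normal_gen nM); exact: Lf.
- by case: (SM) => nM _; apply: (normal_subst nM); exact: Lf.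
Qed.

Lemma truth_imp (I AP : Type) (F : nframe I) (v : AP -> set F)
    (f g : form I AP) (x : F) :
  truth v (Imp f g) x <-> (truth v f x -> truth v g x).
Proof.
split=> [H fx|H [fx]]; last by apply; exact: H.
by apply: contrapT => ngx; exact: H.
Qed.

Lemma truth_dia (I AP : Type) (F : nframe I) (v : AP -> set F) (i : I)
    (f : form I AP) (x : F) :
  truth v (Dia i f) x <-> ~ tau i x (~` truth v f).
Proof. by []. Qed.

Lemma truth_subst (I AP : Type) (F : nframe I) (v : AP -> set F)
    (s : AP -> form I AP) (f : form I AP) :
  truth v (subst s f) = truth (fun a => truth v (s a)) f.
Proof. by elim: f => //= [g ->|g -> h ->|i g ->]. Qed.

Lemma truth_beval (I AP : Type) (F : nframe I) (v : AP -> set F)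
    (f : form I AP) (x : F) :
  truth v f x <-> beval (fun a => `[<v a x>])
                        (fun i g => `[<tau i x (truth v g)>]) f.
Proof.
elim: f => [|a|g [IH1 IH2]|g [IH1 IH2] h [IH3 IH4]|i g _] //=.
- by split=> /asboolP.
- by split=> [ng|/negP ng /IH1 //]; apply/negP => /IH2.
- by split=> [[/IH1 -> /IH3 ->]|/andP[/IH2 ? /IH4 ?]].
- by split=> /asboolP.
Qed.

(** Reduces soundness to generators: a smallest normal set lies inside this one as soon as its
    generators are valid. *)
Lemma valid_normal (I AP : Type) (p q : AP) (F : nframe I) :
  normal p q [set f | valid F f].
Proof.
split=> [f tf v x|i v x|f g fg vf v x|i f vf v x|s f vf v x].
- exact/truth_beval/tf.
- have FF := tau_filter i x.
  apply/truth_imp => pq; apply/truth_imp => xp.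
  apply: filterS (filterI pq xp) => y [npq yp].
  by apply: contrapT => nq; exact: npq.
- exact: (iffLR (truth_imp _ _ _ _) (fg v x)) (vf v x).
- have FF := tau_filter i x.
  by apply: filterS filterT => y _; exact: vf.
- by rewrite truth_subst.
Qed.

Definition reduct (I J : Type) (r : I -> J) (F : nframe J) : nframe I :=
  @NFrame I F (fun i => tau (r i)) (carrier_neq0 F)
    (fun i => tau_filter (r i)).

Lemma valid_rename (I J AP : Type) (r : I -> J) (F : nframe J)
    (f : form I AP) :
  valid (reduct r F) f -> valid F (rename r f).
Proof.
have E v : @truth I AP (reduct r F) v f = @truth J AP F v (rename r f).
  by elim: f => //= [g ->|g -> h ->|i g ->].
by move=> vf v x; rewrite -E; exact: vf.
Qed.

(** * The logics T and D *)

(* The flag selects T ([true]) or D ([false]). *)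
Definition axTD {I AP : Type} (r : bool) (i : I) (p : AP) : form I AP :=
  Imp (Box i (Atom p)) (if r then Atom p else Dia i (Atom p)).

Definition logicTD {AP : Type} (r : bool) (p q : AP) : set (form unit AP) :=
  add_axiom p q (logicK p q) (axTD r tt p).

Definition tauTD {I : Type} (r : bool) (F : nframe I) (i : I) : Prop :=
  forall (x : F) (U : set F), tau i x U -> if r then U x else U !=set0.

(** The valuation giving every atom the value [U] tests the axiom on the neighborhood [U]. For D,
    upward closure makes the complement of an empty [U] a neighborhood as well, which contradicts
    [Dia]; conversely, two disjoint neighborhoods would have an empty intersection. *)
Lemma valid_axTD (I AP : Type) (r : bool) (F : nframe I) (i : I) (p : AP) :
  valid F (axTD r i p) <-> tauTD r F i.
Proof.
case: r; split=> H.
- by move=> x U xU; have /truth_imp := H (fun=> U) x; exact.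
- by move=> v x; apply/truth_imp; exact: H.
- move=> x U xU; have /truth_imp/(_ xU) := H (fun=> U) x.
  apply: contra_notP => /set0P/negP; rewrite negbK => /eqP U0.
  by have FF := tau_filter i x; apply: filterS xU; rewrite U0.
- move=> v x; apply/truth_imp => xp; apply/truth_dia => xnp.
  have FF := tau_filter i x.
  by have [y [yp]] := H x _ (filterI xp xnp); exact.
Qed.

Lemma validates_logicTD (AP : Type) (p q : AP) (r : bool) (F : nframe unit) :
  validates F (logicTD r p q) <-> tauTD r F tt.
Proof.
split=> [vF|tF].
  by apply/(valid_axTD r F tt p)/vF => M [_]; apply; right.
move=> f; apply: smallest_sub; first exact: valid_normal.
move=> g [|->]; last exact/valid_axTD.
by apply: smallest_sub => //; exact: valid_normal.
Qed.

(** * Soundness for full products *)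

Lemma tauTD_full_prod (r : bool) (X Y : nframe unit) (i : tri) :
  tauTD r X tt -> tauTD r Y tt -> tauTD r (full_prod X Y) i.
Proof.
move=> tX tY [x y] U; case: i => /=.
- move=> [V /tX xV VU]; case: r xV {tX tY} => [xV|[x' xV]].
    exact: VU.
  by exists (x', y); apply: VU.
- move=> [V /tY yV VU]; case: r yV {tX tY} => [yV|[y' yV]].
    exact: VU.
  by exists (x, y'); apply: VU.
- move=> [[W V] /= [/tX xW /tY yV] VU].
  case: r xW yV {tX tY} => [xW yV|[x' xW] [y' yV]].
    exact: VU.
  by exists (x', y'); apply: VU.
Qed.

(** A rectangle [W * V] inside the truth set serves both orders of the boxes: one side is the outer
    neighborhood, and the other is an inner neighborhood common to all its points. *)
Lemma valid_mix (AP : Type) (p : AP) (X Y : nframe unit) :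
  valid (full_prod X Y) (mix p).
Proof.
move=> v [x y]; apply/truth_imp => -[[W V] /= [xW yV] WV].
split.
  exists W => // -[x' _] /= [Wx' ->].
  by exists V => // -[_ y'] /= [-> Vy']; exact: WV.
exists V => // -[_ y'] /= [-> Vy'].
by exists W => // -[x' _] /= [Wx' ->]; exact: WV.
Qed.

Lemma product_logicTD_sound (AP : Type) (p q : AP) (r : bool) :
  add_axiom p q (fusion p q (logicTD r p q) (logicTD r p q) (logicTD r p q))
      (mix p)
    `<=` product_logic (logicTD r p q) (logicTD r p q).
Proof.
move=> f Lf X Y /validates_logicTD tX /validates_logicTD tY; move: f Lf.
apply: smallest_sub; first exact: valid_normal.
move=> f [|->]; last exact: valid_mix.
move: f; apply: smallest_sub; first exact: valid_normal.
have vTD i g : logicTD r p q g -> valid (full_prod X Y) (rename (fun=> i) g).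
  move=> Lg; apply/valid_rename; move: g Lg.
  by apply/validates_logicTD => z U; exact: (tauTD_full_prod tX tY).
by move=> f [[]|] [g Lg <-]; exact: vTD.
Qed.

(** * The canonical model *)

(** Closure under modus ponens alone: generalization and substitution would fail for the formulas
    true at a single world. *)
Definition theory {I AP : Type} (L x : set (form I AP)) : Prop :=
  L `<=` x /\ forall f g, x (Imp f g) -> x f -> x g.

Definition maximal {I AP : Type} (L x : set (form I AP)) : Prop :=
  theory L x /\ forall f, x (Neg f) <-> ~ x f.

Lemma normal_theory (I AP : Type) (p q : AP) (L : set (form I AP)) :
  normal p q L -> theory L L.
Proof. by move=> nL; split=> // f g; exact: (normal_mp nL). Qed.

Lemma theory_taut1 (I AP : Type) (p q : AP) (L x : set (form I AP)) f g :
  normal p q L -> theory L x ->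
  tautology (Imp f g) -> x f -> x g.
Proof.
move=> nL [Lx mpx] t; exact: mpx (Lx _ (normal_taut nL t)).
Qed.

Lemma theory_taut2 (I AP : Type) (p q : AP) (L x : set (form I AP)) f g h :
  normal p q L -> theory L x ->
  tautology (Imp f (Imp g h)) -> x f -> x g -> x h.
Proof.
move=> nL tx t xf; have := theory_taut1 nL tx t xf; exact: tx.2.
Qed.

Ltac taut := move=> ? ? /=; do ?case: (beval _ _ _).

Lemma lindenbaum (I AP : Type) (p q : AP) (L T : set (form I AP)) f :
  normal p q L -> theory L T -> ~ T f ->
  exists x, [/\ maximal L x, T `<=` x & ~ x f].
Proof.
move=> nL tT nTf.
(* Zorn is applied to the sets [A] added to [T], so that the empty chain, whose union is empty,
   yields [T] itself. *)
pose P A := theory L (T `|` A) /\ ~ (T `|` A) f.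
have [F FP totF|A [[tA nAf] maxA]] := @Zorn_bigcup _ P.
  split; last first.
    by case=> // -[A FA Af]; case: (FP A FA) => _; apply; right.
  split=> [g Lg|g h]; first by left; exact: tT.1.
  have step A : F A -> (T `|` A) (Imp g h) -> (T `|` A) g ->
      (T `|` \bigcup_(X in F) X) h.
    move=> FA Agh Ag; have [Th|Ah] := (FP A FA).1.2 g h Agh Ag; first by left.
    by right; exists A.
  move=> [Tgh|[A FA Agh]] [Tg|[B FB Bg]].
  - by left; exact: tT.2 Tgh Tg.
  - by apply: (step B) => //; [left|right].
  - by apply: (step A) => //; [right|left].
  - have [AB|BA] := totF A B FA FB.
      by apply: (step B) => //; right => //; exact: AB.
    by apply: (step A) => //; right => //; exact: BA.
set x := T `|` A in tA nAf; exists x; split => //; last by left.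
have max B : theory L B -> x `<=` B -> ~ x = B -> B f.
  move=> tB xB neB; apply: contrapT => nBf; apply: (maxA B).
    split; first by move=> g Ag; apply: xB; right.
    move=> BA; apply: neB; apply/seteqP; split=> // g Bg.
    by right; exact: BA.
  rewrite /P; have -> : T `|` B = B.
    by apply/setUidPr => g Tg; apply: xB; left.
  by [].
(* The consequences of [g] over [x] form a theory that extends [x] strictly, as it contains [g]; by
   maximality it contains [f]. *)
have ext g : ~ x g -> x (Imp g f).
  move=> nxg; pose B := [set h | x (Imp g h)].
  apply: (max B) => [|h xh|xB].
  - split=> [h Lh|h k].
      by apply: (theory_taut1 nL tA _ (tA.1 _ Lh)); taut.
    by apply: (theory_taut2 nL tA); taut.
  - by apply: (theory_taut1 nL tA _ xh); taut.
  - apply: nxg; rewrite xB; apply: tA.1; apply: (normal_taut nL).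
    by taut.
split=> // g; split=> [xng xg|nxg].
  by apply: nAf; apply: (theory_taut2 nL tA _ xng xg); taut.
apply: contrapT => nxng; apply: nAf.
by apply: (theory_taut2 nL tA _ (ext _ nxg) (ext _ nxng)); taut.
Qed.

Lemma maximal_and (I AP : Type) (p q : AP) (L x : set (form I AP)) f g :
  normal p q L -> maximal L x -> x (And f g) <-> x f /\ x g.
Proof.
move=> nL [tx _]; split=> [xfg|[xf xg]]; last first.
  by apply: (theory_taut2 nL tx _ xf xg); taut.
by split; apply: (theory_taut1 nL tx _ xfg); taut.
Qed.

Lemma maximal_bot (I AP : Type) (p q : AP) (L x : set (form I AP)) :
  normal p q L -> maximal L x -> ~ x Bot.
Proof.
by move=> nL [tx mx]; apply/mx/tx.1/(normal_taut nL).
Qed.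

(** Turns an axiom stated for the fixed atoms [p] and [q] into a scheme in [f] and [g], provided
    that [p <> q]. *)
Definition subst1 {I AP : Type} (p : AP) (f g : form I AP) (a : AP) :
  form I AP := if `[<a = p>] then f else g.

Lemma subst1_eq (I AP : Type) (p : AP) (f g : form I AP) :
  subst1 p f g p = f.
Proof. by rewrite /subst1 asboolT. Qed.

Lemma subst1_neq (I AP : Type) (p a : AP) (f g : form I AP) :
  a <> p -> subst1 p f g a = g.
Proof. by move=> ap; rewrite /subst1 asboolF. Qed.

Lemma normal_axK (I AP : Type) (p q : AP) (L : set (form I AP)) i f g :
  p <> q -> normal p q L ->
  L (Imp (Box i (Imp f g)) (Imp (Box i f) (Box i g))).
Proof.
move=> pq nL; have := normal_subst nL (subst1 p f g) (normal_K nL i).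
by rewrite /= subst1_eq subst1_neq //; exact: nesym.
Qed.

(** Maximal extensions of this theory are exactly the canonical [i]-successors of [x]. *)
Lemma theory_unbox (I AP : Type) (p q : AP) (L x : set (form I AP)) i :
  p <> q -> normal p q L -> theory L x -> theory L [set f | x (Box i f)].
Proof.
move=> pq nL [Lx mpx]; split=> [f Lf|f g xfg].
  exact/Lx/(normal_gen nL).
exact: mpx (mpx _ _ (Lx _ (normal_axK _ _ _ pq nL)) xfg).
Qed.

(** The principal filter generated by the successors, so that neighborhood truth is Kripke truth. *)
Definition kripke_tau {I W : Type} (R : I -> W -> set W) (i : I) (w : W) :
  set_system W := [set U | R i w `<=` U].

Lemma kripke_filter (I W : Type) (R : I -> W -> set W) (i : I) (w : W) :
  Filter (kripke_tau R i w).
Proof.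
split=> [//|U V RU RV v Rv|U V UV RU v /RU]; last exact: UV.
by split; [exact: RU|exact: RV].
Qed.

Definition kripke {I W : Type} (R : I -> W -> set W) (w0 : W) : nframe I :=
  NFrame (ex_intro [set: W] w0 Logic.I) (kripke_filter R).

Definition world {I AP : Type} (L : set (form I AP)) : Type :=
  {x : set (form I AP) | maximal L x}.

Definition canon {I AP : Type} (L : set (form I AP)) (i : I) (w : world L) :
    set (world L) :=
  [set u | forall f, sval w (Box i f) -> sval u f].

Lemma canon_truth (I AP : Type) (p q : AP) (L : set (form I AP))
    (w0 : world L) (f : form I AP) (w : world L) :
  p <> q -> normal p q L ->
  truth (F := kripke (@canon I AP L) w0)
    (fun a => [set w | sval w (Atom a)]) f w <-> sval w f.
Proof.
move=> pq nL; elim: f w => [|a|g IH|g IHg h IHh|i g IH] w /=.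
- by split=> // /(maximal_bot nL (svalP w)).
- by [].
- rewrite (propext ((svalP w).2 g)).
  by split=> ng /IH.
- split=> [[/IHg wg /IHh wh]|/(maximal_and _ _ nL (svalP w))[wg wh]].
    exact/(maximal_and _ _ nL (svalP w)).
  by split; [exact/IHg|exact/IHh].
- split=> [H|wg u Ru]; last exact/IH/Ru.
  apply: contrapT => nwg.
  have [u [mu wu]] := lindenbaum nL (theory_unbox i pq nL (svalP w).1) nwg.
  by by apply; apply/(IH (exist _ u mu))/H => f /wu.
Qed.

Definition relTD {W : Type} (r : bool) (R : W -> set W) : Prop :=
  forall w, if r then R w w else R w !=set0.

Lemma canon_TD (I AP : Type) (p q : AP) (L : set (form I AP)) r i :
  p <> q -> normal p q L -> L (axTD r i p) -> relTD r (@canon I AP L i).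
Proof.
move=> pq nL Lax w; have [tw mw] := svalP w.
have {Lax} ax f : sval w (Box i f) -> sval w (if r then f else Dia i f).
  apply: tw.2; apply: tw.1.
  have := normal_subst nL (subst1 p f f) Lax.
  by case: (r) => /=; rewrite subst1_eq.
case: r ax => [ax f|ax]; first exact: ax.
(* [Box i Bot] in [w] would give [Dia i Bot], against the theorem [Box i (Neg Bot)] of [L]. *)
have nwbot : ~ [set f | sval w (Box i f)] Bot.
  move=> /= /ax/mw; apply; apply: tw.1; apply: (normal_gen nL).
  exact: (normal_taut nL).
have [u [mu wu _]] := lindenbaum nL (theory_unbox i pq nL tw) nwbot.
by exists (exist _ u mu).
Qed.

Lemma canon_mix (AP : Type) (p q : AP) (L : set (form tri AP)) :
  normal p q L -> L (mix p) ->
  forall w u v : world L,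
    (canon b1 w u /\ canon b2 u v) \/ (canon b2 w u /\ canon b1 u v) ->
    canon b12 w v.
Proof.
move=> nL Lmix w u v wuv f wf; have [tw _] := svalP w.
have := normal_subst nL (subst1 p f f) Lmix; rewrite /= subst1_eq.
move=> /tw.1/tw.2/(_ wf)/(maximal_and _ _ nL (svalP w))[w12 w21].
by case: wuv => -[wu uv]; apply: uv; apply: wu.
Qed.

(** * Words over the worlds *)

(** Meant for [size s <= N]: blanks fill [s] up to length [N], and the letter sits at position
    [N]. *)
Definition pad {W : Type} (s : seq (option W)) (N : nat) (a : W) :
  seq (option W) := rcons (mkseq (nth None s) N) (Some a).

(** Neighborhoods of [s] cannot refer to the other word of a pair; the bound [k] allows one to be
    chosen whose new letters all lie beyond the end of that word. *)
Definition wnbhd {W : Type} (r : bool) (s : seq (option W)) (k : nat) :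
    set (seq (option W)) :=
  [set s' | (r /\ s' = s) \/
            exists N a, [/\ k <= N, size s <= N & s' = pad s N a]].

Lemma wnbhd_filter (W : Type) (r : bool) (s : seq (option W)) :
  Filter (filter_from setT (wnbhd r s)).
Proof.
apply: filter_from_filter; first by exists 0.
move=> k l _ _; exists (maxn k l) => // s' [rs|[N [a [+ sN ->]]]].
  by split; left.
by rewrite geq_max => /andP[kN lN]; split; right; exists N, a.
Qed.

Definition word_frame {W : Type} (r : bool) : nframe unit :=
  NFrame (ex_intro [set: seq (option W)] [::] Logic.I)
    (fun _ => wnbhd_filter r).

Lemma word_frameTD (W : Type) (r : bool) (w0 : W) :
  tauTD r (@word_frame W r) tt.
Proof.
move=> s U /= [k _ kU]; case: ifP => rT; first by apply: kU; left.
exists (pad s (maxn k (size s)) w0); apply: kU; right.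
by exists (maxn k (size s)), w0; rewrite leq_maxl leq_maxr.
Qed.

(** * Reading a pair of words as a path *)

Section Merge.
Variables (W : Type) (next : tri -> W -> W -> W) (w0 : W).
Implicit Types (s t : seq (option W)).

(* [next i w a] is [a] whenever [a] is an [R i]-successor of [w], so a
   simultaneous pair of letters [a], [b] can afford to ignore [b]. *)
Definition step (w : W) (a b : option W) : W :=
  match a, b with
  | None, None => w
  | Some a, None => next b1 w a
  | None, Some b => next b2 w b
  | Some a, Some _ => next b12 w a
  end.

Fixpoint run s t n : W :=
  if n is m.+1 then step (run s t m) (nth None s m) (nth None t m) else w0.

Definition merge (z : seq (option W) * seq (option W)) : W :=
  run z.1 z.2 (maxn (size z.1) (size z.2)).

(** Past the ends of both words the default [None] is read twice, and [step] then stays in place. *)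
Lemma merge_run s t n : size s <= n -> size t <= n -> merge (s, t) = run s t n.
Proof.
move=> sn tn; have mn : maxn (size s) (size t) <= n by rewrite geq_max sn.
rewrite /merge /= -(subnKC mn); elim: (n - _) => [|d IH]; first by rewrite addn0.
have md : maxn (size s) (size t) <= maxn (size s) (size t) + d.
  exact: leq_addr.
by move: (md); rewrite addnS /= geq_max => /andP[sd td]; rewrite !nth_default.
Qed.

Lemma eq_run s s' t t' n :
  (forall i, i < n -> nth None s i = nth None s' i) ->
  (forall i, i < n -> nth None t i = nth None t' i) ->
  run s t n = run s' t' n.
Proof.
elim: n => //= n IH es et; rewrite es // et // IH // => i /ltnW; auto.
Qed.

Lemma size_pad s N (a : W) : size (pad s N a) = N.+1.
Proof. by rewrite size_rcons size_mkseq. Qed.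

Lemma nth_pad s N (a : W) i : i < N -> nth None (pad s N a) i = nth None s i.
Proof. by move=> iN; rewrite nth_rcons size_mkseq iN nth_mkseq. Qed.

Lemma nth_pad_last s N (a : W) : nth None (pad s N a) N = Some a.
Proof. by rewrite nth_rcons size_mkseq ltnn eqxx. Qed.

(** Both words are over by position [N], so the new letter is read last and faces a default
    blank. *)
Lemma merge_pad1 s t N a : size s <= N -> size t <= N ->
  merge (pad s N a, t) = next b1 (merge (s, t)) a.
Proof.
move=> sN tN; rewrite (@merge_run _ _ N.+1) ?size_pad ?(leqW tN) //=.
rewrite nth_pad_last (nth_default _ tN) /= (@merge_run s t N) //.
by congr next; apply: eq_run => // i /nth_pad.
Qed.

Lemma merge_pad2 s t N a : size s <= N -> size t <= N ->
  merge (s, pad t N a) = next b2 (merge (s, t)) a.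
Proof.
move=> sN tN; rewrite (@merge_run _ _ N.+1) ?size_pad ?(leqW sN) //=.
rewrite nth_pad_last (nth_default _ sN) /= (@merge_run s t N) //.
by congr next; apply: eq_run => // i /nth_pad.
Qed.

Lemma merge_pad12 s t N a b : size s <= N -> size t <= N ->
  merge (pad s N a, pad t N b) = next b12 (merge (s, t)) a.
Proof.
move=> sN tN; rewrite (@merge_run _ _ N.+1) ?size_pad //=.
rewrite !nth_pad_last /= (@merge_run s t N) //.
by congr next; apply: eq_run => i /nth_pad.
Qed.

Lemma merge_tau (r : bool) (R : tri -> W -> set W) :
  (forall i w a, R i w (next i w a)) ->
  (forall i w a, R i w a -> next i w a = a) ->
  (forall i, relTD r (R i)) ->
  (forall w u v, (R b1 w u /\ R b2 u v) \/ (R b2 w u /\ R b1 u v) ->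
     R b12 w v) ->
  forall i (z : full_prod (word_frame r) (word_frame r)) (U : set W),
    tau i z (merge @^-1` U) <-> R i (merge z) `<=` U.
Proof.
move=> Rnext nextR Rr Rmix i [s t] U.
have refl j w : r -> R j w w by move=> rT; have := Rr j w; rewrite rT.
pose m := maxn (size s) (size t).
have sm : size s <= m by exact: leq_maxl.
have tm : size t <= m by exact: leq_maxr.
have large k : exists N, [/\ k <= N, size s <= N & size t <= N].
  exists (k + m); split; first exact: leq_addr.
    exact: leq_trans sm (leq_addl _ _).
  exact: leq_trans tm (leq_addl _ _).
split; case: i => /=.
- move=> [V [k _ kV] VU] u Ru; have [N [kN sN tN]] := large k.
  (* The letter [u] itself is appended, since [next] leads to [u] when [u] is a successor. *)
  rewrite -(nextR _ _ _ Ru) -(merge_pad1 _ sN tN); apply: VU; split=> //.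
  by apply: kV; right; exists N, u.
- move=> [V [k _ kV] VU] u Ru; have [N [kN sN tN]] := large k.
  rewrite -(nextR _ _ _ Ru) -(merge_pad2 _ sN tN); apply: VU; split=> //.
  by apply: kV; right; exists N, u.
- move=> [[V V'] /= [[k _ kV] [l _ lV]] VU] u Ru.
  have [N [klN sN tN]] := large (maxn k l).
  move: klN; rewrite geq_max => /andP[kN lN].
  rewrite -(nextR _ _ _ Ru) -(merge_pad12 _ u sN tN); apply: VU.
  by split; [apply: kV|apply: lV]; right; exists N, u.
(* The threshold [m] places every new letter past the ends of both words. *)
- move=> RU; exists (wnbhd r s m); first by exists m.
  move=> [s' _] /= [+ ->] => -[[rT ->]|[N [a [mN sN ->]]]]; apply: RU.
    exact: refl.
  by rewrite merge_pad1 // (leq_trans tm).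
- move=> RU; exists (wnbhd r t m); first by exists m.
  move=> [_ t'] /= [-> +] => -[[rT ->]|[N [a [mN tN ->]]]]; apply: RU.
    exact: refl.
  by rewrite merge_pad2 // (leq_trans sm).
- move=> RU; exists (wnbhd r s m, wnbhd r t m).
    by split; exists m.
  move=> [s' t'] /= [+ +].
  move=> [[rT ->]|[N [a [mN sN ->]]]] [[rT' ->]|[M [b [mM tM ->]]]]; apply: RU.
  + exact: refl.
  (* A word left unchanged, possible only for T, counts as a reflexive step, so [Rmix] applies. *)
  + rewrite merge_pad2 ?(leq_trans sm) //.
    by apply: (Rmix _ (merge (s, t))); left; split; [exact: refl|].
  + rewrite merge_pad1 ?(leq_trans tm) //.
    by apply: (Rmix _ (merge (s, t))); right; split; [exact: refl|].
  (* The earlier letter is read first: the order of [N] and [M] selects the half of [Rmix], and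
     equality gives a single [b12]-step. *)
  + have [NM|MN|->] := ltngtP N M.
    * rewrite merge_pad2 ?size_pad // merge_pad1 ?(leq_trans tm) //.
      by apply: (Rmix _ (next b1 (merge (s, t)) a)); left; split; exact: Rnext.
    * rewrite merge_pad1 ?size_pad // merge_pad2 ?(leq_trans sm) //.
      by apply: (Rmix _ (next b2 (merge (s, t)) b)); right; split; exact: Rnext.
    * by rewrite merge_pad12 ?(leq_trans sm).
Qed.

End Merge.

(** * Completeness by pulling back a canonical refutation *)

Lemma truth_pullback (I AP : Type) (F G : nframe I) (h : F -> G)
    (v : AP -> set G) (f : form I AP) :
  (forall i x (U : set G), tau i x (h @^-1` U) <-> tau i (h x) U) ->
  truth (fun a => h @^-1` v a) f = h @^-1` truth v f.
Proof.
move=> htau; elim: f => //= [g ->|g -> k ->|i g ->] //.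
by apply/seteqP; split=> x /htau.
Qed.

(** When [a] is not a successor of [w], reflexivity or seriality supplies one to use instead. *)
Lemma exists_next (I W : Type) (r : bool) (R : I -> W -> set W) :
  (forall i, relTD r (R i)) ->
  exists next : I -> W -> W -> W,
    (forall i w a, R i w (next i w a)) /\
    (forall i w a, R i w a -> next i w a = a).
Proof.
move=> Rr.
have [|next nextP] := @choice (I * W * W) W
    (fun x u => R x.1.1 x.1.2 u /\ (R x.1.1 x.1.2 x.2 -> u = x.2)).
  move=> [[i w] a] /=; have [Ra|nRa] := pselect (R i w a); first by exists a.
  have := Rr i w; case: r {Rr} => [Rw|[u Ru]]; first by exists w.
  by exists u.
by exists (fun i w a => next (i, w, a)); split=> i w a;
  have [] := nextP (i, w, a).
Qed.

Lemma product_logicTD_complete (AP : Type) (p q : AP) (r : bool) :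
  p <> q ->
  product_logic (logicTD r p q) (logicTD r p q)
    `<=` add_axiom p q
      (fusion p q (logicTD r p q) (logicTD r p q) (logicTD r p q)) (mix p).
Proof.
move=> pq f; set L := add_axiom _ _ _ _ => Pf; apply: contrapT => nLf.
have nL : normal p q L by exact: smallest_normal.
have LTD i : L (axTD r i p).
  have Lax : logicTD r p q (axTD r tt p) by move=> M [_]; apply; right.
  have -> : axTD r i p = rename (fun=> i) (axTD r tt p) by case: (r).
  move=> M [_]; apply; left => N [_]; apply.
  by case: i; [left; left|left; right|right]; exists (axTD r tt p).
have Lmix : L (mix p) by move=> M [_]; apply; right.
have Rr i := canon_TD pq nL (LTD i).
have [x [mx _ nxf]] := lindenbaum nL (normal_theory nL) nLf.
pose w0 : world L := exist _ x mx.
have [next [Rnext nextR]] := exists_next Rr.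
have htau := merge_tau w0 Rnext nextR Rr (canon_mix nL Lmix).
have vTD : validates (@word_frame (world L) r) (logicTD r p q).
  exact/validates_logicTD/(word_frameTD w0).
(* The pair of empty words is read as the root [w0], where [f] fails. *)
have := Pf _ _ vTD vTD
  (fun a => merge next w0 @^-1` [set w | sval w (Atom a)]) ([::], [::]).
rewrite (truth_pullback (G := kripke (@canon _ _ L) w0) _ _ htau).
by move=> /(canon_truth _ _ _ pq nL).
Qed.

Theorem theorem1p4 (AP : Type) (p q : AP) (pq : p <> q) :
  product_logic (logicT p q) (logicT p q)
    = add_axiom p q (fusion p q (logicT p q) (logicT p q) (logicT p q)) (mix p)
  /\ product_logic (logicD p q) (logicD p q)
    = add_axiom p q (fusion p q (logicD p q) (logicD p q) (logicD p q)) (mix p).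
Proof.
split; apply/seteqP; split.
- exact: (@product_logicTD_complete AP p q true).
- exact: (@product_logicTD_sound AP p q true).
- exact: (@product_logicTD_complete AP p q false).
- exact: (@product_logicTD_sound AP p q false).
Qed.
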